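(* Let $(R,\mathfrak m)$ and $(S,\mathfrak n)$ be Noetherian (standard graded) local rings. If there exists a surjective (graded) ring homomorphism $\varphi:R\to S$, then $\operatorname{ms}(R)\ge\operatorname{ms}(S)$ and $\operatorname{cs}(R)\ge\operatorname{cs}(S)$.
   Context: All rings are commutative with unity. A ''Noetherian (standard graded) local ring $(R,\mathfrak m)$'' means either a Noetherian local ring with maximal ideal $\mathfrak m$, or a Noetherian standard graded ring $R=\bigoplus_{i\ge 0}R_i$ with $R_0$ a field, $R=R_0[R_1]$ and $\mathfrak m=\bigoplus_{i\ge1}R_i$; words in parentheses (''(homogeneous)'', ''(graded)'') apply in the graded case, and in the statement either both rings are local or both are standard graded. Put $k=R/\mathfrak m$ and $\mu(I)=\dim_k(I/\mathfrak m I)$, the minimal number of generators of a (homogeneous) ideal $I$. Define $$\operatorname{cs}(R)=\min\{\mu(I): I\subseteq\mathfrak m \text{ a (homogeneous) ideal with } I^2=\mathfrak m^2\},$$ $$\operatorname{ms}(R)=\min\{\mu(I): I\subseteq \mathfrak m \text{ a (homogeneous) ideal with } I\supseteq \mathfrak m^2\}.$$ *)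

(* Defs.v *)
From HB Require Import structures.
From mathcomp Require Import all_boot all_order all_algebra.
From mathcomp Require Import boolp classical_sets.

Set Implicit Arguments.
Unset Strict Implicit.
Unset Printing Implicit Defensive.

Import GRing.Theory.
Local Open Scope ring_scope.
Local Open Scope quotient_scope.

(* [idealr R] is the library's type of proper ideals; arbitrary ideals, possibly
   equal to R, are the submodules of the regular module. *)
Notation ideal R := (submodClosed R^o).

Section QuotientByIdealMultiples.
Variables (R : comNzRingType) (m : idealr R) (M : lmodType R).

(* The submodule mM of M. *)
Definition ideal_smul : {pred M} := fun x =>
  `[< exists s : seq (R * M), all (fun p => p.1 \in m) s
        /\ x = \sum_(p <- s) p.1 *: p.2 >].

Lemma ideal_smulZ a v : a \in m -> a *: v \in ideal_smul.
Proof.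
by move=> am; apply/asboolP; exists [:: (a, v)]; rewrite /= am big_seq1.
Qed.

Lemma ideal_smul_scale a v : v \in ideal_smul -> a *: v \in ideal_smul.
Proof.
move=> /asboolP[s [sm ->]]; apply/asboolP.
exists [seq (a * p.1, p.2) | p <- s]; split; last first.
  by rewrite scaler_sumr big_map; apply: eq_bigr => p _; rewrite scalerA.
by rewrite all_map; apply: sub_all sm => p /= /(idealMr a).
Qed.

Fact ideal_smul_zmod_closed : zmod_closed ideal_smul.
Proof.
split=> [|u v]; first by apply/asboolP; exists [::]; rewrite big_nil.
move=> /asboolP[s [sm ->]] /(ideal_smul_scale (-1)) /asboolP[t [tm]].
rewrite scaleN1r => ->; apply/asboolP.
by exists (s ++ t); rewrite all_cat sm tm big_cat.
Qed.

HB.instance Definition _ :=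
  GRing.isZmodClosed.Build M ideal_smul ideal_smul_zmod_closed.

(* M / mM, as a module over R / m. *)
Definition red_mod := {ideal_quot ideal_smul}.

HB.instance Definition _ := GRing.Zmodule.on red_mod.

Definition red_scale (a : {ideal_quot m}) (x : red_mod) : red_mod :=
  \pi_red_mod (repr a *: repr x).

Lemma red_scaleE (a : R) (v : M) :
  red_scale (\pi a) (\pi_red_mod v) = \pi_red_mod (a *: v).
Proof.
rewrite /red_scale; apply/eqP; rewrite -Quotient.idealrBE.
set b := repr _; set w := repr _.
have bm : b - a \in m by rewrite Quotient.idealrBE reprK.
have wv : w - v \in ideal_smul by rewrite Quotient.idealrBE reprK.
have -> : b *: w - a *: v = (b - a) *: w + a *: (w - v).
  by rewrite scalerBl scalerBr addrA subrK.
by apply: rpredD; [apply: ideal_smulZ | apply: ideal_smul_scale].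
Qed.

Fact red_scaleA a b x : red_scale a (red_scale b x) = red_scale (a * b) x.
Proof.
elim/quotW: a => a; elim/quotW: b => b; elim/quotW: x => x.
by rewrite -[\pi a * _]rmorphM (red_scaleE b) (red_scaleE a) red_scaleE scalerA.
Qed.

Fact red_scale1 : left_id 1 red_scale.
Proof. by elim/quotW=> x; rewrite -(rmorph1 \pi) red_scaleE scale1r. Qed.

Fact red_scaleDr : right_distributive red_scale +%R.
Proof.
elim/quotW=> a; elim/quotW=> x; elim/quotW=> y.
by rewrite -raddfD (red_scaleE a x) (red_scaleE a y) red_scaleE scalerDr raddfD.
Qed.

Fact red_scaleDl x : {morph red_scale^~ x : a b / a + b}.
Proof.
elim/quotW: x => x; elim/quotW=> a; elim/quotW=> b /=.
by rewrite -raddfD (red_scaleE a x) (red_scaleE b x) red_scaleE scalerDl raddfD.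
Qed.

HB.instance Definition _ := GRing.Zmodule_isLmodule.Build
  {ideal_quot m} red_mod red_scaleA red_scale1 red_scaleDr red_scaleDl.

End QuotientByIdealMultiples.

Section Dimension.
Variables (K : nzRingType) (V : lmodType K).

(* V is isomorphic to K^n. *)
Definition has_dim (n : nat) : Prop := inhabited (Vector.axiom n V).

(* The junk value 0 is taken when V is not finite dimensional. *)
Definition dimension : nat := xget 0 [set n | has_dim n].

End Dimension.

(* The junk value 0 is taken when A is empty. *)
Definition min_nat (A : set nat) : nat :=
  xget 0 [set a | A a /\ forall b, A b -> (a <= b)%N].

Section Ideals.
Variable R : comNzRingType.

Definition ideal_module (I : ideal R) := {x : R^o | x \in I}.

HB.instance Definition _ (I : ideal R) := SubChoice.on (ideal_module I).
HB.instance Definition _ (I : ideal R) :=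
  [SubChoice_isSubLmodule of ideal_module I by <:].

(* dim_k (I / mI) where k = R / m *)
Definition mu (m : idealr R) (I : ideal R) : nat :=
  dimension (red_mod m (ideal_module I)).

Definition ideal_mul (A B : {pred R}) : {pred R} := fun x =>
  `[< exists s : seq (R * R), all (fun p => (p.1 \in A) && (p.2 \in B)) s
        /\ x = \sum_(p <- s) p.1 * p.2 >].

Definition noetherian : Prop :=
  forall I : ideal R, exists (r : nat) (g : 'I_r -> R),
    forall x, x \in I <-> exists a : 'I_r -> R, x = \sum_i a i * g i.

Definition maximal_ideal (m : idealr R) : Prop :=
  forall J : idealr R, {subset m <= J} -> J =i m.

Definition noetherian_local (m : idealr R) : Prop :=
  [/\ noetherian, maximal_ideal m
    & forall J : idealr R, maximal_ideal J -> J =i m].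

(* G i is the homogeneous component of degree i; the first three clauses say
   that R is the direct sum of the G i, as a graded ring. *)
Definition noetherian_standard_graded
    (G : nat -> zmodClosed R) (m : idealr R) : Prop :=
  [/\ forall i j x y, x \in G i -> y \in G j -> x * y \in G (i + j)%N,
      forall x, exists (d : nat) (f : nat -> R),
        (forall i, f i \in G i) /\ x = \sum_(0 <= i < d) f i,
      forall (d : nat) (f : nat -> R), (forall i, f i \in G i) ->
        \sum_(0 <= i < d) f i = 0 -> forall i, (i < d)%N -> f i = 0,
      1 \in G 0%N
        /\ (forall x, x \in G 0%N -> x != 0 ->
              exists2 y, y \in G 0%N & x * y = 1)
    & [/\ forall A : subringClosed R,
            {subset G 0%N <= A} -> {subset G 1%N <= A} -> forall x, x \in A,
          noetherian
        & forall x, x \in m <-> exists (d : nat) (f : nat -> R),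
            (forall i, f i \in G i) /\ x = \sum_(1 <= i < d) f i]].

Definition homogeneous (G : nat -> zmodClosed R) (I : ideal R) : Prop :=
  forall (d : nat) (f : nat -> R), (forall i, f i \in G i) ->
    \sum_(0 <= i < d) f i \in I -> forall i, (i < d)%N -> f i \in I.

(* [adm] selects the ideals over which the minimum is taken. *)
Definition cs_among (adm : ideal R -> Prop) (m : idealr R) : nat :=
  min_nat [set mu m I | I in [set I : ideal R |
    [/\ adm I, {subset I <= m} & ideal_mul I I =i ideal_mul m m]]].

Definition ms_among (adm : ideal R -> Prop) (m : idealr R) : nat :=
  min_nat [set mu m I | I in [set I : ideal R |
    [/\ adm I, {subset I <= m} & {subset ideal_mul m m <= I}]]].

Definition cs (m : idealr R) : nat := cs_among (fun=> True) m.
Definition ms (m : idealr R) : nat := ms_among (fun=> True) m.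

Definition graded_cs (G : nat -> zmodClosed R) (m : idealr R) : nat :=
  cs_among (homogeneous G) m.
Definition graded_ms (G : nat -> zmodClosed R) (m : idealr R) : nat :=
  ms_among (homogeneous G) m.

End Ideals.

Definition graded_morphism (R S : comNzRingType) (G : nat -> zmodClosed R)
    (H : nat -> zmodClosed S) (phi : R -> S) : Prop :=
  forall i x, x \in G i -> phi x \in H i.

(* Main.v *)
(* If I is an ideal of R as in the definition of cs(R) or ms(R), its image J in S
   is one for S, because the maximal ideal n is the image of m; and the surjection
   I/mI -> J/nJ over R/m -> S/n gives mu(J) <= mu(I). In the local case n is the
   image of m since the preimage of n is a maximal ideal; in the graded case a
   nonzero component of degree 0 is a unit, so phi does not kill it. *)
Require Import Defs.
From HB Require Import structures.
From mathcomp Require Import all_boot all_order all_algebra.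
From mathcomp Require Import boolp classical_sets.

Set Implicit Arguments.
Unset Strict Implicit.
Unset Printing Implicit Defensive.

Import GRing.Theory.
Local Open Scope ring_scope.
Local Open Scope quotient_scope.

(** * Dimension and spanning families *)

Definition spanned (K : nzRingType) (V : lmodType K) (n : nat) : Prop :=
  exists g : 'I_n -> V, forall v, exists c : 'I_n -> K, v = \sum_i c i *: g i.

Lemma has_dim_spanned (K : nzRingType) (V : lmodType K) n :
  has_dim V n -> spanned V n.
Proof.
move=> [[f f_lin [g fK gK]]].
pose L : {linear V -> 'rV[K]_n} := HB.pack f (GRing.isLinear.Build _ _ _ _ f f_lin).
exists (fun i => g (delta_mx 0 i)) => v; exists (f v 0).
apply: (can_inj fK); rewrite [RHS](linear_sum L) [LHS]row_sum_delta.
by apply: eq_bigr => i _; rewrite linearZ /= gK.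
Qed.

(** Expanding the standard basis of K^d in [h], and [h] in coordinates, gives [A *m B = 1] with [A]
    of size d by n, which over a commutative ring forces d <= n. *)
Lemma has_dim_le_spanned (K : comNzRingType) (V : lmodType K) d n :
  has_dim V d -> spanned V n -> (d <= n)%N.
Proof.
move=> [[f f_lin [g fK gK]]] [h /choice[c cE]].
pose L : {linear V -> 'rV[K]_d} := HB.pack f (GRing.isLinear.Build _ _ _ _ f f_lin).
pose A := \matrix_(i < d, j < n) c (g (delta_mx 0 i)) j.
pose B := \matrix_(j < n) f (h j).
apply: (@mulmx1_min _ _ _ A B); apply/row_matrixP => i.
rewrite row_mul mulmx_sum_row row1 -[RHS]gK [in RHS](cE (g _)).
rewrite [RHS](linear_sum L); apply: eq_bigr => j _.
by rewrite linearZ /= rowK !mxE.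
Qed.

Lemma spanned_has_dim (K : nzRingType) (V : lmodType K) n :
  (forall x : K, x != 0 -> exists y, y * x = 1) ->
  spanned V n -> exists d, has_dim V d.
Proof.
move=> Kinv; elim: n => [|n IHn] [g gV].
  exists 0; split; exists (fun=> 0) => [a u v|].
    by rewrite scaler0 addr0.
  exists (fun=> 0) => u; last by apply/rowP => -[].
  by have [c ->] := gV u; rewrite big_ord0.
have [gfree|] := pselect (forall c : 'I_n.+1 -> K,
    \sum_i c i *: g i = 0 -> forall i, c i = 0).
  exists n.+1; have [f fE] := choice gV.
  have f_uniq v c : v = \sum_i c i *: g i -> f v = c.
    move=> vE; apply/funext => i; apply/eqP; rewrite -subr_eq0; apply/eqP.
    apply: (gfree (fun i => f v i - c i)).
    under eq_bigr do rewrite scalerBl.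
    by rewrite sumrB -fE -vE subrr.
  split; exists (fun v => \row_i f v i) => [a u v|].
    apply/rowP => i; rewrite !mxE.
    rewrite (f_uniq _ (fun i => a * f u i + f v i)) //.
    rewrite {1}(fE u) {1}(fE v) scaler_sumr -big_split /=.
    by apply: eq_bigr => j _; rewrite scalerDl scalerA.
  exists (fun r : 'rV[K]_n.+1 => \sum_i r 0 i *: g i) => [v|r].
    by rewrite [RHS]fE /=; apply: eq_bigr => i _; rewrite mxE.
  by apply/rowP => i; rewrite mxE (f_uniq _ (r 0)).
move=> /existsNP[c] /not_implyP[c0 /existsNP[j /eqP /Kinv[y yc]]].
apply: IHn; exists (g \o lift j) => v; have [a vE] := gV v.
(* Subtracting [a j * y] times the relation [c] from the expansion of [v] cancels the coefficient of
   [g j], since [y * c j = 1]. *)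
exists (fun i => a (lift j i) - a j * y * c (lift j i)) => /=.
rewrite -(subr0 v) -[in LHS](scaler0 _ (a j * y)) -[in LHS]c0 [in LHS]vE scaler_sumr -sumrB.
rewrite (bigD1_ord j) //= scalerA -scalerBl -mulrA yc mulr1 subrr scale0r add0r.
by apply: eq_bigr => i _; rewrite scalerBl scalerA.
Qed.

Lemma has_dim_dimension (K : nzRingType) (V : lmodType K) d :
  has_dim V d -> has_dim V (dimension V).
Proof. by move=> Vd; apply: (@xgetPex _ 0 [set n | has_dim V n]); exists d. Qed.

(* No existence of a dimension is needed: the junk value 0 satisfies the bound. *)
Lemma dimension_le_spanned (K : comNzRingType) (V : lmodType K) n :
  spanned V n -> (dimension V <= n)%N.
Proof.
rewrite /dimension; case: xgetP => [d _ Vd|_ _ //].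
exact: has_dim_le_spanned.
Qed.

(** The least element of [A] bounds some element of [B], hence the minimum of [B]; nonemptiness of
    [A] keeps the junk value 0 off the right-hand side. *)
Lemma min_nat_mono (A B : set nat) :
  (exists a, A a) -> (forall a, A a -> exists2 b, B b & (b <= a)%N) ->
  (min_nat B <= min_nat A)%N.
Proof.
move=> [a Aa] AB; have exA : exists n, `[< A n >] by exists a; apply/asboolP.
rewrite {2}/min_nat; case: xgetP => [a0 -> [/AB[b Bb ba0] _]|noA].
  apply: leq_trans ba0; rewrite /min_nat.
  by case: xgetP => // c _ [_ cmin]; apply: cmin.
have [n /asboolP An nmin] := ex_minnP exA.
by case: (noA n); split=> // b /asboolP; apply: nmin.
Qed.

(** * Spanning families of M/mM under a semilinear surjection *)

Lemma red_mod_surj (R : comNzRingType) (m : idealr R) (M : lmodType R)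
    (x : red_mod m M) : exists v : M, x = \pi_(red_mod m M) v.
Proof. by exists (repr x); rewrite reprK. Qed.

Lemma red_mod_scaleE (R : comNzRingType) (m : idealr R) (M : lmodType R) a v :
  (\pi_{ideal_quot m} a : {ideal_quot m}) *: (\pi_(red_mod m M) v : red_mod m M)
  = \pi_(red_mod m M) (a *: v).
Proof. exact: red_scaleE. Qed.

(** The semilinear [f] sends mM into nN, so the images under [f] of lifts of the generators still
    span. The argument runs on representatives, without an induced map of quotients. *)
Lemma red_mod_spanned_surj (R S : comNzRingType) (m : idealr R) (n : idealr S)
    (phi : {rmorphism R -> S}) (M : lmodType R) (N : lmodType S)
    (f : {additive M -> N}) k :
  (forall a v, f (a *: v) = phi a *: f v) ->
  (forall w, exists v, f v = w) ->
  (forall x : R, x \in m -> phi x \in n) ->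
  spanned (red_mod m M) k -> spanned (red_mod n N) k.
Proof.
move=> fZ f_surj phi_mn [g gM].
exists (fun i => \pi_(red_mod n N) (f (repr (g i)))) => y.
have [w ->] := red_mod_surj y; have [v <-] := f_surj w.
have [c vE] := gM (\pi_(red_mod m M) v).
exists (fun i => \pi_{ideal_quot n} (phi (repr (c i)))).
under eq_bigr do rewrite red_mod_scaleE -fZ.
rewrite -raddf_sum -(raddf_sum f); apply/eqP; rewrite -Quotient.idealrBE.
rewrite -raddfB; set u := (X in f X).
have /asboolP[s [sm ->]] : u \in ideal_smul m (M := M).
  rewrite Quotient.idealrBE; apply/eqP; rewrite [LHS]vE.
  rewrite [RHS](raddf_sum \pi_(red_mod m M)); apply: eq_bigr => i _.
  by rewrite -[c i in LHS]reprK -[g i in LHS]reprK; apply: red_mod_scaleE.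
rewrite raddf_sum big_seq; apply: rpred_sum => p ps.
by rewrite fZ; apply: ideal_smulZ; apply: phi_mn; apply: (allP sm).
Qed.

(** * Ideals given by a predicate *)

Lemma ideal_spec (R : comNzRingType) (P : R -> Prop) :
  P 0 -> (forall x y, P x -> P y -> P (x + y)) ->
  (forall a x, P x -> P (a * x)) ->
  exists I : ideal R, forall x, x \in I <-> P x.
Proof.
move=> P0 PD PM; pose p : {pred R^o} := fun x => `[< P x >].
have pP : submod_closed p.
  split=> [|a u v /asboolP Pu /asboolP Pv]; first exact/asboolP.
  by apply/asboolP/PD => //; apply: PM.
pose I : ideal R := HB.pack p (GRing.isSubmodClosed.Build R R^o p pP).
by exists I => x; split=> [/asboolP|Px] //; apply/asboolP.
Qed.

Lemma idealr_spec (R : comNzRingType) (P : R -> Prop) :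
  P 0 -> ~ P 1 -> (forall x y, P x -> P y -> P (x + y)) ->
  (forall a x, P x -> P (a * x)) ->
  exists I : idealr R, forall x, x \in I <-> P x.
Proof.
move=> P0 P1 PD PM; pose p : {pred R} := fun x => `[< P x >].
have pP : idealr_closed p.
  split=> [||a u v /asboolP Pu /asboolP Pv]; first exact/asboolP.
    exact/asboolP.
  by apply/asboolP/PD => //; apply: PM.
pose I : idealr R := HB.pack p (isIdealr.Build R p pP).
by exists I => x; split=> [/asboolP|Px] //; apply/asboolP.
Qed.

(** Lets m itself compete in the minima defining [ms] and [cs], which range over the type
    [ideal R]. *)
Lemma ideal_of_idealr (R : comNzRingType) (m : idealr R) :
  exists I : ideal R, I =i m.
Proof.
have [|||I IE] := @ideal_spec R (fun x => x \in m).
- exact: rpred0.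
- exact: rpredD.
- exact: idealMr.
by exists I => x; apply/idP/idP => /IE.
Qed.

(** R/m is a field, phrased through inverses modulo m; the local and the graded case both supply
    it. *)
Definition residue_field (R : comNzRingType) (m : idealr R) : Prop :=
  forall x, x \notin m -> exists y, y * x - 1 \in m.

Definition is_image (R S : comNzRingType) (phi : R -> S) (A : {pred R})
    (B : {pred S}) : Prop :=
  forall y, y \in B <-> exists2 x, x \in A & phi x = y.

(** * Images of ideals under a surjective ring homomorphism *)

Section Surjection.
Variables (R S : comNzRingType) (m : idealr R) (n : idealr S).
Variable phi : {rmorphism R -> S}.
Hypothesis phi_surj : forall y : S, exists x : R, phi x = y.

(** Surjectivity makes the image stable under multiplication by all of S. *)
Lemma ideal_image (I : ideal R) : exists J : ideal S, is_image phi I J.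
Proof.
apply: ideal_spec => [|x y [u uI <-] [v vI <-]|a x [u uI <-]].
- by exists 0; [exact: (rpred0 I) | rewrite rmorph0].
- by exists (u + v); [exact: (rpredD uI vI) | rewrite rmorphD].
have [b <-] := phi_surj a.
by exists (b * u); [exact: (@rpredZ R R^o I b u uI) | rewrite rmorphM].
Qed.

(** Sums of products lift factor by factor. This carries the conditions relating I to m^2 over to
    the images. *)
Lemma ideal_mul_image (A B : {pred R}) (A' B' : {pred S}) :
  is_image phi A A' -> is_image phi B B' ->
  is_image phi (ideal_mul A B) (ideal_mul A' B').
Proof.
move=> AE BE y; split=> [/asboolP[s [sAB ->]]|[_ /asboolP[s [sAB ->]] <-]].
  elim: s sAB => [_|p s IHs /= /andP[/andP[/AE[a aA a_p] /BE[b bB b_p]]]].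
    exists 0; last by rewrite rmorph0 big_nil.
    by apply/asboolP; exists [::]; rewrite big_nil.
  move=> /IHs[_ /asboolP[t [tAB ->]] tE].
  exists (\sum_(q <- (a, b) :: t) q.1 * q.2).
    by apply/asboolP; exists ((a, b) :: t); rewrite /= aA bB.
  by rewrite !big_cons /= rmorphD rmorphM a_p b_p tE.
apply/asboolP; exists [seq (phi p.1, phi p.2) | p <- s]; split.
  rewrite all_map; apply/allP => p /(allP sAB)/andP[pA pB] /=.
  by apply/andP; split; [apply/AE; exists p.1 | apply/BE; exists p.2].
by rewrite big_map rmorph_sum; apply: eq_bigr => p _; rewrite rmorphM.
Qed.

(** Noetherianity gives finitely many generators of I, whose classes span I/mI over the field R/m.
    Hence [mu m I] is a true dimension rather than the junk value. *)
Lemma red_mod_has_dim (I : ideal R) :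
  noetherian R -> residue_field m ->
  exists d, has_dim (red_mod m (ideal_module I)) d.
Proof.
move=> /(_ I)[r [g gI]] m_field; apply: (@spanned_has_dim _ _ r).
  elim/quotW => x; rewrite -(rmorph0 \pi_{ideal_quot m}) -Quotient.idealrBE subr0.
  move=> /m_field[y yx]; exists (\pi y); rewrite -rmorphM -(rmorph1 \pi).
  by apply/eqP; rewrite -Quotient.idealrBE.
have g_in i : g i \in I.
  apply/gI; exists (fun j => (j == i)%:R).
  rewrite (bigD1 i) //= eqxx mul1r big1 ?addr0 // => j /negPf->.
  by rewrite mul0r.
pose h i : ideal_module I := exist _ (g i) (g_in i).
exists (fun i => \pi_(red_mod m (ideal_module I)) (h i)) => v.
have [w ->] := red_mod_surj v.
have [a wE] := (gI (val w)).1 (valP w).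
exists (fun i => \pi_{ideal_quot m} (a i)); under eq_bigr do rewrite red_mod_scaleE.
rewrite -raddf_sum; congr (\pi _); apply: val_inj.
by rewrite wE raddf_sum; apply: eq_bigr => i _.
Qed.

Lemma mu_image_le (I : ideal R) (J : ideal S) :
  noetherian R -> residue_field m -> (forall x : R, x \in m -> phi x \in n) ->
  is_image phi I J -> (mu n J <= mu m I)%N.
Proof.
move=> R_noeth m_field phi_mn IJ.
have [d /has_dim_dimension/has_dim_spanned] := red_mod_has_dim I R_noeth m_field.
have phiI (x : ideal_module I) : phi (val x) \in J.
  by apply/IJ; exists (val x) => //; apply: valP.
pose f (x : ideal_module I) : ideal_module J := exist _ (phi (val x)) (phiI x).
have fB : zmod_morphism f.
  by move=> x y; apply: val_inj; rewrite /= rmorphB.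
pose F : {additive ideal_module I -> ideal_module J} :=
  HB.pack f (GRing.isZmodMorphism.Build _ _ f fB).
move=> span_I; apply: dimension_le_spanned.
apply: (@red_mod_spanned_surj R S m n phi _ _ F _ _ _ phi_mn span_I).
  by move=> a v; apply: val_inj; rewrite /= rmorphM.
move=> w; have /IJ[x xI xw] := valP w.
by exists (exist _ x xI); apply: val_inj.
Qed.

(** Common core of both cases: [admR] and [admS] will be trivial for local rings and homogeneity for
    graded ones. Taking images sends each candidate I to a candidate J with [mu n J <= mu m I]. *)
Lemma ms_cs_among_le (admR : ideal R -> Prop) (admS : ideal S -> Prop) :
  noetherian R -> residue_field m -> is_image phi m n ->
  (exists2 I : ideal R, admR I & I =i m) ->
  (forall (I : ideal R) (J : ideal S), is_image phi I J -> admR I -> admS J) ->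
  (ms_among admS n <= ms_among admR m)%N /\
  (cs_among admS n <= cs_among admR m)%N.
Proof.
move=> R_noeth m_field mn [M M_adm ME] adm_image.
have phi_mn x : x \in m -> phi x \in n by move=> xm; apply/mn; exists x.
have mu_le I J := @mu_image_le I J R_noeth m_field phi_mn.
have sub_image (I : ideal R) (J : ideal S) :
    is_image phi I J -> {subset I <= m} -> {subset J <= n}.
  by move=> IJ Im y /IJ[x /Im xm <-]; apply: phi_mn.
have mm_m : {subset ideal_mul m m <= m}.
  move=> x /asboolP[s [sm ->]]; rewrite big_seq; apply: rpred_sum => p ps.
  by apply: idealMr; case/andP: (allP sm p ps).
split; apply: min_nat_mono => [|_ [I [I_adm Im I_mm] <-]].
(* The ideal m, as [M], shows that the set of candidates is nonempty. *)
- exists (mu m M); exists M => //; split=> // x; first by rewrite ME.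
  by move=> /mm_m; rewrite ME.
- have [J IJ] := ideal_image I; exists (mu n J); last exact: mu_le.
  exists J => //; split; [exact: adm_image IJ I_adm | exact: sub_image IJ Im |].
  move=> y /(ideal_mul_image mn mn)[x /I_mm xI <-].
  by apply/IJ; exists x.
- exists (mu m M); exists M => //; split=> // x; first by rewrite ME.
  apply/asboolP/asboolP => -[s [sm ->]]; exists s; split=> //;
    by apply: sub_all sm => p; rewrite !ME.
have [J IJ] := ideal_image I; exists (mu n J); last exact: mu_le.
exists J => //; split; [exact: adm_image IJ I_adm | exact: sub_image IJ Im |].
move=> y; apply/idP/idP.
  move=> /(ideal_mul_image IJ IJ)[x]; rewrite I_mm => x_mm <-.
  by apply/(ideal_mul_image mn mn); exists x.
move=> /(ideal_mul_image mn mn)[x]; rewrite -I_mm => x_II <-.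
by apply/(ideal_mul_image IJ IJ); exists x.
Qed.

(** * Maximal ideals and the local case *)

(** Without an inverse of x modulo m, the ideal m + Rx would be proper, hence equal to m by
    maximality, although it contains x. *)
Lemma maximal_residue_field : maximal_ideal m -> residue_field m.
Proof.
move=> m_max x xm; apply: contrapT => /forallNP x_ninv.
have [||||J JE] := @idealr_spec R (fun z => exists y, z - y * x \in m).
- by exists 0; rewrite mul0r subr0 rpred0.
- by move=> [y]; rewrite -opprB rpredN; apply: x_ninv.
- move=> u v [y uy] [z vz]; exists (y + z).
  by rewrite mulrDl opprD addrACA rpredD.
- by move=> a u [y uy]; exists (a * y); rewrite -mulrA -mulrBr idealMr.
case/negP: xm; rewrite -(m_max J).
  by apply/JE; exists 1; rewrite mul1r subrr rpred0.
by move=> y ym; apply/JE; exists 0; rewrite mul0r subr0.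
Qed.

(** A proper ideal J above the preimage contains the kernel of [phi], so its image [K] is still
    proper; maximality of n gives K = n, so J lies in the preimage. *)
Lemma maximal_preimage : maximal_ideal n ->
  exists2 P : idealr R, maximal_ideal P & forall x, x \in P = (phi x \in n).
Proof.
move=> n_max; have [||||P PE] := @idealr_spec R (fun x => phi x \in n).
- by rewrite rmorph0 rpred0.
- by rewrite rmorph1 idealr1.
- by move=> x y xn yn; rewrite rmorphD rpredD.
- by move=> a x xn; rewrite rmorphM idealMr.
have PE' x : x \in P = (phi x \in n) by apply/idP/idP => /PE.
exists P => // J PJ x; apply/idP/idP => [xJ|/PJ //].
have phiJ y : phi y \in n -> y \in J by rewrite -PE' => /PJ.
have [||||K KE] := @idealr_spec S (fun y => exists2 x, x \in J & phi x = y).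
- by exists 0; rewrite ?rpred0 ?rmorph0.
- move=> [u uJ u1]; have : u - (u - 1) \in J.
    by rewrite rpredB // phiJ // rmorphB u1 rmorph1 subrr rpred0.
  by rewrite subKr idealr1.
- by move=> _ _ [u uJ <-] [v vJ <-]; exists (u + v); rewrite ?rpredD ?rmorphD.
- move=> a _ [u uJ <-]; have [b <-] := phi_surj a.
  by exists (b * u); rewrite ?idealMr ?rmorphM.
rewrite PE' -(n_max K); first by apply/KE; exists x.
by move=> y yn; have [z zy] := phi_surj y; apply/KE; exists z; rewrite ?phiJ ?zy.
Qed.

Lemma local_is_image : noetherian_local m -> noetherian_local n ->
  is_image phi m n.
Proof.
move=> [_ _ m_uniq] [_ n_max _]; have [P /m_uniq Pm PE] := maximal_preimage n_max.
move=> y; split=> [yn|[x]]; last by rewrite -Pm PE => + <-.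
by have [x xy] := phi_surj y; exists x; rewrite // -Pm PE xy.
Qed.

End Surjection.

(** * Homogeneous components and the irrelevant ideal *)

Section Graded.
Variables (R : comNzRingType) (G : nat -> zmodClosed R) (m : idealr R).
Hypothesis Gm : noetherian_standard_graded G m.

(** The expansions may differ in length, so both are padded with zeros up to [maxn d e] before
    directness is applied to their difference; hence the value 0 in degrees from [e] on. *)
Lemma component_uniq d e (f g : nat -> R) :
  (forall i, f i \in G i) -> (forall i, g i \in G i) ->
  \sum_(0 <= i < d) f i = \sum_(0 <= i < e) g i ->
  forall i, (i < d)%N -> f i = if (i < e)%N then g i else 0.
Proof.
have [_ _ G_direct _ _] := Gm; move=> fG gG fg i id.
pose pad k (h : nat -> R) j := if (j < k)%N then h j else 0.
have padE k h : (k <= maxn d e)%N ->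
    \sum_(0 <= j < k) h j = \sum_(0 <= j < maxn d e) pad k h j.
  by move=> kde; rewrite (big_nat_widen _ _ _ _ _ kde) big_mkcond.
have padG k h j : (forall j, h j \in G j) -> pad k h j \in G j.
  by move=> hG; rewrite /pad; case: ifP; rewrite ?rpred0.
have /(G_direct (maxn d e)) uniq0 j : pad d f j - pad e g j \in G j.
  by rewrite rpredB ?padG.
have /eqP : pad d f i - pad e g i = 0.
  apply: uniq0; last by rewrite leq_max id.
  by rewrite sumrB -!padE ?leq_maxl ?leq_maxr // fg subrr.
by rewrite subr_eq0 {1}/pad id => /eqP.
Qed.

(** The length is made positive so that a degree 0 component is always present. *)
Lemma graded_decomposition x : exists d (f : nat -> R),
  (forall i, f i \in G i) /\ x = \sum_(0 <= i < d.+1) f i.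
Proof.
have [_ /(_ x)[[|d] [f [fG xE]]] _ _ _] := Gm; last by exists d, f.
exists 0, (fun=> 0); split=> [i|]; first exact: rpred0.
by rewrite xE big_geq // big1.
Qed.

(** Elements of m have an expansion starting in degree 1, so by uniqueness of components the degree
    0 component detects membership. *)
Lemma sum_in_irrelevant d (f : nat -> R) : (forall i, f i \in G i) ->
  (\sum_(0 <= i < d.+1) f i \in m) = (f 0 == 0).
Proof.
have [_ _ _ _ [_ _ mE]] := Gm; move=> fG; apply/idP/eqP => [/mE[e [g [gG]]]|f0].
  pose g' i := if i == 0 then 0 else g i.
  have -> : \sum_(1 <= i < e) g i = \sum_(0 <= i < e) g' i.
    case: e => [|e]; first by rewrite !big_geq.
    rewrite [RHS]big_ltn // add0r; apply: eq_big_nat => i /andP[].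
    by case: i.
  move=> /component_uniq -> //; first by case: ifP.
  by move=> i; rewrite /g'; case: ifP => // _; apply: rpred0.
by apply/mE; exists d.+1, f; rewrite big_ltn // f0 add0r.
Qed.

Lemma irrelevant_homogeneous (I : ideal R) : I =i m -> homogeneous G I.
Proof.
move=> Im d f fG; rewrite Im => f_m [|i].
  by case: d f_m => // d; rewrite sum_in_irrelevant // => /eqP-> _; apply: (rpred0 I).
(* The family concentrated in degree [i.+1] vanishes in degree 0, so its sum lies in m. *)
rewrite Im => _; pose g j := if j == i.+1 then f i.+1 else 0.
have -> : f i.+1 = \sum_(0 <= j < i.+2) g j.
  rewrite big_nat_recr //= {2}/g eqxx big_nat big1 ?add0r // => j /andP[_ ji].
  by rewrite /g ltn_eqF.
rewrite sum_in_irrelevant // => j; rewrite /g.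
by case: eqP => [->|_] //; apply: rpred0.
Qed.

(** Modulo m, an element equals its degree 0 component; outside m that component is nonzero, hence
    invertible. *)
Lemma graded_residue_field : residue_field m.
Proof.
have [_ _ _ [_ G0_inv] _] := Gm.
move=> x; have [d [f [fG ->]]] := graded_decomposition x.
rewrite sum_in_irrelevant // => /(G0_inv _ (fG 0))[y yG f0y].
exists y; rewrite big_ltn // mulrDr mulrC f0y addrAC subrr add0r idealMr //.
have [_ _ _ _ [_ _ mE]] := Gm.
by apply/mE; exists d.+1, f.
Qed.

End Graded.

(** * Graded surjections *)

Section GradedSurjection.
Variables (R S : comNzRingType) (m : idealr R) (n : idealr S).
Variables (G : nat -> zmodClosed R) (H : nat -> zmodClosed S).
Variable phi : {rmorphism R -> S}.
Hypothesis phi_surj : forall y : S, exists x : R, phi x = y.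
Hypothesis Gm : noetherian_standard_graded G m.
Hypothesis Hn : noetherian_standard_graded H n.
Hypothesis phi_graded : graded_morphism G H phi.

Lemma graded_is_image : is_image phi m n.
Proof.
have [_ _ _ [_ G0_inv] _] := Gm.
have phi_m x : (phi x \in n) = (x \in m).
  have [d [f [fG ->]]] := graded_decomposition Gm x.
  rewrite rmorph_sum (sum_in_irrelevant Hn) => [|i]; last exact: phi_graded.
  rewrite (sum_in_irrelevant Gm) //; apply/eqP/eqP => [phi0|->].
    apply: contrapT => /eqP/(G0_inv _ (fG 0))[y _ /(congr1 phi)/eqP].
    by rewrite rmorphM phi0 mul0r rmorph1 eq_sym oner_eq0.
  exact: rmorph0.
move=> y; split=> [yn|[x xm <-]]; last by rewrite phi_m.
by have [x xy] := phi_surj y; exists x; rewrite // -phi_m xy.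
Qed.

(** An element of J lifts to some x in I; by uniqueness its components are the images of those of x,
    which lie in I. *)
Lemma homogeneous_image (I : ideal R) (J : ideal S) :
  is_image phi I J -> homogeneous G I -> homogeneous H J.
Proof.
move=> IJ I_homog d h hH /IJ[x xI]; have [e [f [fG xE]]] := graded_decomposition Gm x.
rewrite xE rmorph_sum => /esym fh i id.
rewrite (component_uniq Hn hH _ fh) // => [|j]; last exact: phi_graded.
case: ifP => [ie|_]; last exact: (rpred0 J).
by apply/IJ; exists (f i) => //; apply: I_homog fG _ _ ie; rewrite -xE.
Qed.

End GradedSurjection.

Theorem proposition2p10 (R S : comNzRingType) (m : idealr R) (n : idealr S)
    (phi : {rmorphism R -> S}) (phi_surj : forall y : S, exists x : R, phi x = y) :
  (noetherian_local m -> noetherian_local n ->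
     (ms n <= ms m)%N /\ (cs n <= cs m)%N)
  /\
  (forall (G : nat -> zmodClosed R) (H : nat -> zmodClosed S),
     noetherian_standard_graded G m -> noetherian_standard_graded H n ->
     graded_morphism G H phi ->
     (graded_ms H n <= graded_ms G m)%N /\ (graded_cs H n <= graded_cs G m)%N).
Proof.
split=> [R_local S_local | G H R_graded S_graded phi_graded].
  have [R_noeth m_max _] := R_local.
  apply: (ms_cs_among_le phi_surj R_noeth) => //.
  - exact: maximal_residue_field.
  - exact: local_is_image.
  by have [M ME] := ideal_of_idealr m; exists M.
have [_ _ _ _ [_ R_noeth _]] := R_graded.
apply: (ms_cs_among_le phi_surj R_noeth).
- exact: graded_residue_field R_graded.
- exact: graded_is_image R_graded S_graded phi_graded.
- have [M ME] := ideal_of_idealr m.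
  by exists M => //; apply: irrelevant_homogeneous R_graded _ ME.
- exact: homogeneous_image R_graded S_graded phi_graded.
Qed.
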